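(* Assume $2^\omega=\omega_1$ and $2^{\omega_1}=\omega_2$, and assume there is a stationary set $S\subseteq\omega_2$ such that (a) $\mathrm{cf}(\alpha)=\omega$ for every $\alpha\in S$, and (b) $S\cap\beta$ is not stationary in $\beta$ for every $\beta<\omega_2$ with $\mathrm{cf}(\beta)=\omega_1$. Fix such $S$ and a sequence $\langle\nu_\xi:\xi\in S\rangle$ of finitely additive probability measures $\nu_\xi$ on $Ba^<[\xi]$ such that for every finitely additive probability measure $\nu$ on $Ba[\omega_2]$ the set $\{\xi\in S:\nu|_{Ba^<[\xi]}=\nu_\xi\}$ is stationary in $\omega_2$. Let $\langle\mathfrak A_\xi:\xi<\omega_2\rangle$ be a sequence of algebras of subsets of $2^{\omega_2}$ such that: (i) $\mathcal C[\xi]\subseteq\mathfrak A_\xi\subseteq Ba^<[\xi]$ for every $\xi<\omega_2$; (ii) $\mathfrak A_\xi=\bigcup_{\alpha<\xi}\mathfrak A_\alpha$ for every limit ordinal $\xi<\omega_2$; (iii) whenever $\alpha\in\omega_2\setminus S$ and $\alpha<\beta<\omega_2$, every strictly positive finitely additive probability measure on $\mathfrak A_\alpha$ can be extended to a strictly positive finitely additive probability measure on $\mathfrak A_\beta$; (iv) for every $\xi\in S$, $\nu_\xi|_{\mathfrak A_\xi}$ cannot be extended to a strictly positive finitely additive probability measure on $\mathfrak A_{\xi+1}$. Then the algebra $\mathfrak A=\bigcup_{\xi<\omega_2}\mathfrak A_\xi$ (of cardinality $\mathfrak c^+$) is not in $\mathsf{SPM}$, but $\mathfrak B\in\mathsf{SPM}$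 for every subalgebra $\mathfrak B$ of $\mathfrak A$ of cardinality at most $\mathfrak c$.
   Context: $\mathfrak c=2^\omega$. A Boolean algebra $\mathfrak A$ is in $\mathsf{SPM}$ if there is a finitely additive $\mu:\mathfrak A\to\mathbb R_+$ with $\mu(a)>0$ for every nonzero $a\in\mathfrak A$; a measure is strictly positive if it is positive on all nonzero (nonempty) elements. Consider the Cantor cube $2^{\omega_2}$; an ordinal $\beta$ is identified with $\{\alpha:\alpha<\beta\}$. A set $A\subseteq 2^{\omega_2}$ is determined by coordinates in $J\subseteq\omega_2$ if whenever $x\in A$ and $y$ agrees with $x$ on $J$, then $y\in A$. $\mathcal C[J]$ is the family of sets determined by coordinates in some finite subset of $J$, $Ba[J]$ is the $\sigma$-algebra generated by $\mathcal C[J]$, and $Ba^<[\xi]=\bigcup_{\beta<\xi}Ba[\beta]$. A subset of a limit ordinal $\gamma$ is stationary in $\gamma$ if it meets every closed unbounded subset of $\gamma$ (in the order topology).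
   Formalization: Condition (i) is unsatisfiable as written (at ξ=0 and at successor ξ); it is replaced by C[ξ] ⊆ A_ξ ⊆ Ba[ξ] for every ξ, with A_ξ ⊆ Ba^<[ξ] required only for limit ξ. *)

(* Defs.v *)
From HB Require Import structures.
From mathcomp Require Import all_boot all_order all_algebra.
From mathcomp Require Import all_classical all_reals.
From mathcomp Require Import topology measurable_structure.
From mathcomp Require wochoice.

Set Implicit Arguments.
Unset Strict Implicit.
Unset Printing Implicit Defensive.

Import Order.TTheory GRing.Theory Num.Theory.
Local Open Scope classical_set_scope.
Local Open Scope card_scope.
Local Open Scope ring_scope.

(* A has the least cardinality greater than that of B; every cardinality up to
   that of A is realized by a subset of A. *)
Definition is_card_succ (T U : Type) (A : set T) (B : set U) : Prop :=
  [/\ B #<= A, ~ (A #<= B) & forall C : set T, C `<=` A -> C #<= B \/ C #= A].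

Section Ordinals.
Context {d : Order.disp_t} (W : orderType d).

(* W has the order type of an initial ordinal, i.e. of a cardinal. *)
Definition initial_ordinal : Prop :=
  wochoice.well_order (<=%O : rel W) /\
  forall x : W, ~ ([set: W] #<= [set y : W | (y < x)%O]).

Definition is_omega1 : Prop :=
  initial_ordinal /\ is_card_succ [set: W] [set: nat].

Definition is_omega2 d1 (W1 : orderType d1) : Prop :=
  initial_ordinal /\ is_card_succ [set: W] [set: W1].

Definition cofinal (D : set W) : Prop :=
  forall x : W, exists2 y, D y & (x <= y)%O.

(* K is a set whose cardinality is the cofinality of W. *)
Definition has_cofinality (U : Type) (K : set U) : Prop :=
  (exists2 D : set W, cofinal D & D #= K) /\
  (forall D : set W, cofinal D -> K #<= D).

Definition stationary (S : set W) : Prop :=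
  forall C : set (order_topology W), closed C -> cofinal C -> S `&` C !=set0.

Implicit Types xi eta : W.

Definition limit_ordinal xi : Prop :=
  (exists eta, (eta < xi)%O) /\
  forall eta, (eta < xi)%O -> exists zeta, (eta < zeta)%O && (zeta < xi)%O.

(* eta = xi + 1 *)
Definition is_succ xi eta : Prop :=
  (xi < eta)%O /\ forall zeta, (xi < zeta)%O -> (eta <= zeta)%O.

Definition initseg xi : set W := [set alpha | (alpha < xi)%O].

End Ordinals.

(* The ordinal xi = {alpha : alpha < xi} as an ordered type of its own, so that
   its cofinality and the stationarity of its subsets are the notions above. *)
Section OrdinalType.
Context {d : Order.disp_t} (W : orderType d) (xi : W).

Definition ord_type : Type := {alpha : W | (alpha < xi)%O}.
HB.instance Definition _ := SubType.on ord_type.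
HB.instance Definition _ :=
  Order.Total.copy ord_type (sub_type {alpha : W | (alpha < xi)%O}).

Definition ord_trace (S : set W) : set ord_type :=
  [set alpha | S (val alpha)].

End OrdinalType.

Arguments ord_trace {d W} xi S.

Section Cube.
Context {I : Type}.
Implicit Types (J : set I) (A : set (I -> bool)).

Definition determined_by J A : Prop :=
  forall x y, A x -> (forall j, J j -> y j = x j) -> A y.

Definition Cyl J : set (set (I -> bool)) :=
  [set A | exists F, [/\ finite_set F, F `<=` J & determined_by F A]].

Definition Ba J : set (set (I -> bool)) := <<s Cyl J >>.

End Cube.

Section BaLt.
Context {d : Order.disp_t} {W : orderType d}.
Implicit Type xi : W.

(* For xi = 0 this is empty, and for xi = beta + 1 it is Ba[beta], which does
   not contain the cylinders over the coordinate beta. Hence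
   Cyl[xi] <= A_xi <= BaLt xi is possible only at limit xi, and at the other xi
   the upper bound has to be Ba[xi]. *)
Definition BaLt xi : set (set (W -> bool)) :=
  \bigcup_(beta in initseg xi) Ba (initseg beta).

Lemma BaLt_sub_Ba xi : BaLt xi `<=` Ba (initseg xi).
Proof.
move=> A [beta /= ltb]; apply: (sub_smallest2r (smallest_sigma_algebra _ _)).
move=> E [F [finF sF detF]]; exists F; split=> // x /sF /= ltx.
exact: lt_trans ltx ltb.
Qed.

Lemma Cyl_not_sub_BaLt0 xi :
  (forall alpha, (xi <= alpha)%O) -> ~ (Cyl (initseg xi) `<=` BaLt xi).
Proof.
move=> xi0 /(_ setT) [|beta /= ltb _]; first by exists set0; split.
by have := xi0 beta; rewrite leNgt ltb.
Qed.

End BaLt.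

Section Measures.
Context {T : Type}.
Implicit Types F G : set (set T).

Definition set_algebra F : Prop := setring F /\ F setT.

Context (R : realType).
Implicit Types mu nu : set T -> R.

(* A measure on F is a total function of which only the values on F matter. *)
Definition fa_measure F mu : Prop :=
  (forall A, F A -> 0 <= mu A) /\
  (forall A B, F A -> F B -> A `&` B = set0 -> mu (A `|` B) = mu A + mu B).

Definition fa_probability F mu : Prop := fa_measure F mu /\ mu setT = 1.

Definition strictly_positive F mu : Prop :=
  forall A, F A -> A !=set0 -> 0 < mu A.

Definition SPM F : Prop :=
  exists mu, fa_measure F mu /\ strictly_positive F mu.

Definition agree_on F mu nu : Prop := forall A, F A -> mu A = nu A.

Definition sp_extension F mu G nu : Prop :=
  [/\ F `<=` G, agree_on F nu mu, fa_probability G nu & strictly_positive G nu].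

End Measures.

(* Main.v *)
(* By (iii), starting from the trivial algebra A_0 (0 is not in S), every A_xi
   carries a strictly positive probability measure, and the sequence is
   increasing. A subalgebra of size at most c lies in a single A_xi by the
   regularity of omega_2, hence is in SPM. A strictly positive measure on the
   union extends, after normalization, to a finitely additive probability on the
   whole power set; by the choice of the nu_xi this extension agrees with some
   nu_xi on Ba^<[xi], contradicting (iv). The union has size at most omega_2
   since, under CH, each Ba[xi] has size at most c. *)
Require Import Defs.
From HB Require Import structures.
From mathcomp Require Import all_boot all_order all_algebra.
From mathcomp Require Import all_classical all_reals.
From mathcomp Require Import topology measurable_structure normedtype.

Set Implicit Arguments.
Unset Strict Implicit.
Unset Printing Implicit Defensive.

Import Order.TTheory GRing.Theory Num.Theory.
Import numFieldNormedType.Exports.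
Local Open Scope classical_set_scope.
Local Open Scope card_scope.
Local Open Scope ring_scope.

(** * Cardinalities up to the power set of the continuum *)

Lemma card_le_inj T U (A : set T) (B : set U) (f : T -> U) :
  set_fun A B f -> {in A &, injective f} -> A #<= B.
Proof.
move=> fAB finj; suff: $|{injfun A >-> B}| by case=> g; exact: inj_card_le g.
by apply/injfunPex; exists f.
Qed.

Lemma card_le_injT T U (f : T -> U) : injective f -> [set: T] #<= [set: U].
Proof. by move=> finj; apply: (@card_le_inj _ _ _ _ f) => // x y _ _ /finj. Qed.

Lemma card_le_injP T U :
  [set: T] #<= [set: U] -> exists f : T -> U, injective f.
Proof.
elim/Ppointed: U => U.
  rewrite card_le_emptyr => /eqP T0; have nT (x : T) : False.
    by have : [set: T] x by []; rewrite T0.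
  by exists (fun x => match nT x with end) => x; case: (nT x).
by case/pcard_injP=> f finj; exists f => x y; apply: finj; rewrite inE.
Qed.

Lemma image_set_inj T U (f : T -> U) :
  injective f -> injective (fun X : set T => f @` X).
Proof.
move=> finj X Y /= XY; apply/seteqP; split=> x xX.
- have : (f @` Y) (f x) by rewrite -XY; apply: imageP.
  by case=> y Yy /finj <-.
- have : (f @` X) (f x) by rewrite XY; apply: imageP.
  by case=> y Xy /finj <-.
Qed.

Lemma card_le_powerset T U :
  [set: T] #<= [set: U] -> [set: set T] #<= [set: set U].
Proof. by case/card_le_injP=> f /image_set_inj; exact: card_le_injT. Qed.

Lemma card_le_powerset_countable (C : countType) :
  [set: set C] #<= [set: set nat].
Proof. exact/card_le_injT/image_set_inj/(pcan_inj pickleK). Qed.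

Lemma card_le_continuum_prod : [set: set nat * set nat] #<= [set: set nat].
Proof.
apply: card_le_trans (card_le_powerset_countable (nat + nat)%type).
pose f (p : set nat * set nat) : set (nat + nat) :=
  [set z | match z with inl n => p.1 n | inr n => p.2 n end].
apply: (@card_le_injT _ _ f) => -[a b] [a' b'] /= E; congr pair; apply/seteqP.
- by split=> n; have := congr1 (@^~ (inl n)) E; rewrite /f /= => ->.
- by split=> n; have := congr1 (@^~ (inr n)) E; rewrite /f /= => ->.
Qed.

Lemma card_le_continuum_sum : [set: set nat + set nat] #<= [set: set nat].
Proof.
apply: card_le_trans card_le_continuum_prod.
pose f (p : set nat + set nat) : set nat * set nat :=
  match p with inl a => (a, set0) | inr a => (a, setT) end.
apply: (@card_le_injT _ _ f) => -[a|a] [b|b] /= [-> // E].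
- by have : [set: nat] 0%N by []; rewrite -E.
- by have : [set: nat] 0%N by []; rewrite E.
Qed.

(** A point of the union is recovered from the index of one fibre containing it, coded by a set of
    subsets of nat, and its own code within that fibre. *)
Lemma card_le_bigcup_continuum W V (F : W -> set V) :
  [set: W] #<= [set: set (set nat)] ->
  (forall x, F x #<= [set: set nat]) ->
  \bigcup_x F x #<= [set: set (set nat)].
Proof.
case/card_le_injP => e einj Fle.
have [w0|W0] := pselect (exists w : W, True); last first.
  rewrite (_ : \bigcup_x _ = set0) ?card_ge0// -subset0 => v [x _ _].
  by apply: W0; exists x.
case: w0 => w0 _.
have /choice[h hinj] x := elimT pcard_injP (Fle x).
have /choice[rk rkP] (v : V) : exists x, (\bigcup_x F x) v -> F x v.
  have [[x _ Fxv]|nv] := pselect ((\bigcup_x F x) v); first by exists x.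
  by exists w0.
apply: card_le_trans (card_le_powerset card_le_continuum_sum).
pose f v : set (set nat + set nat) := [set z | match z with
  | inl u => e (rk v) u | inr u => u = h (rk v) v end].
apply: (@card_le_inj _ _ _ _ f) => // v v'; rewrite !inE => Fv Fv' E.
have rkE : rk v = rk v'.
  by apply: einj; apply/funext => u; exact: (congr1 (fun z : set _ => z (inl u)) E).
have := congr1 (@^~ (inr (h (rk v) v))) E; rewrite /f /= -rkE => Eh.
have {Eh} : h (rk v) v = h (rk v) v' by rewrite -Eh.
by apply: hinj; rewrite inE; [exact: rkP|rewrite rkE; exact: rkP].
Qed.

(** * Size of a generated sigma-algebra *)

(* A node denotes the union of the complements of its children. *)
Inductive sigma_code := Leaf of set nat | Node of (nat -> sigma_code).

(* The node at the path s of c is branching iff (s, None) is a member, and is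
   otherwise labelled by the n such that (s, Some n) is. *)
Fixpoint graph_code (c : sigma_code) : set (seq nat * option nat) :=
  match c with
  | Leaf a => [set p | p.1 = [::] /\ exists2 n, p.2 = Some n & a n]
  | Node f => [set p | if p.1 is i :: s then graph_code (f i) (s, p.2)
                       else p.2 = None]
  end.

(** The pair [([::], None)] tells a node from a leaf, and the paths beginning with [i] isolate child
    [i]. This embeds the codes into the subsets of a countable type. *)
Lemma graph_code_inj : injective graph_code.
Proof.
elim=> [a|f IH] [b|g] /= E.
- congr Leaf; apply/seteqP; split=> n an.
  + have : ([set p | p.1 = [::] /\ exists2 n, p.2 = Some n & a n]
      : set (seq nat * option nat)) ([::], Some n) by split=> //; exists n.
    by rewrite E => -[_ [m [->]]].
  + have : ([set p | p.1 = [::] /\ exists2 n, p.2 = Some n & b n]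
      : set (seq nat * option nat)) ([::], Some n) by split=> //; exists n.
    by rewrite -E => -[_ [m [->]]].
- have /= := congr1 (@^~ ([::], None)) E.
  by move=> H; suff [_ [m]] : [::] = [::] :> seq nat /\
       exists2 n : nat, None = Some n & a n by []; rewrite H.
- have /= := congr1 (@^~ ([::], None)) E.
  by move=> H; suff [_ [m]] : [::] = [::] :> seq nat /\
       exists2 n : nat, None = Some n & b n by []; rewrite -H.
- congr Node; apply/funext => i; apply: IH; apply/funext => -[s o].
  exact: (congr1 (fun z : set _ => z (i :: s, o)) E).
Qed.

Section GeneratedSigmaAlgebra.
Variables (T : Type) (d : set nat -> set T).

Fixpoint decode (c : sigma_code) : set T :=
  match c with
  | Leaf a => d a
  | Node f => \bigcup_i ~` decode (f i)
  end.

(** A node with constant children gives complements; countable unions follow by taking codes of the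
    complements as children. *)
Lemma sigma_algebra_decode : <<s range d >> `<=` range decode.
Proof.
apply: smallest_sub; last by move=> _ [a _ <-]; exists (Leaf a).
have rC A : range decode A -> range decode (~` A).
  case=> c _ <-; exists (Node (fun=> c)) => //=; exact: bigcup_const.
have rU (A : nat -> set T) :
    (forall n, range decode (A n)) -> range decode (\bigcup_k A k).
  move=> rA; have /choice[f fP] n : exists c, decode c = ~` A n.
    by have [c] := rC _ (rA n); exists c.
  exists (Node f) => //=; apply: eq_bigcupr => i _.
  by rewrite fP setCK.
split=> //; last by move=> A rA; rewrite setTD; exact: rC.
(* The empty set arises as the complement of the union of one generator, arbitrarily [d set0], and
   its complement. *)
pose A (n : nat) : set T := if n is 0%N then d set0 else ~` d set0.
have d0 : range decode (d set0) by exists (Leaf set0).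
have /rC : range decode (\bigcup_n A n).
  by apply: rU => -[|n] //=; exact: rC.
rewrite (_ : \bigcup_n A n = setT) ?setCT//; apply/seteqP; split=> // x _.
have [dx|ndx] := pselect (d set0 x); first by exists 0%N.
by exists 1%N.
Qed.

End GeneratedSigmaAlgebra.

Lemma card_sigma_algebra_continuum T (G : set (set T)) :
  G #<= [set: set nat] -> <<s G >> #<= [set: set nat].
Proof.
case/pcard_surjP=> d Gd.
have sG : <<s G >> `<=` <<s range d >> by exact: sub_smallest2r.
apply: card_le_trans (subset_card_le sG) _.
apply: card_le_trans (subset_card_le (@sigma_algebra_decode _ d)) _.
apply: card_le_trans (card_image_le _ _) _.
apply: card_le_trans (card_le_injT graph_code_inj) _.
exact: card_le_powerset_countable.
Qed.

(** Induction on the finite list of coordinates: fixing the value at [j] yields two sets determined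
    by the remaining coordinates, and [A] is glued from them along the half-space at [j]. The
    half-spaces are at most as many as the elements of [J]. *)
Lemma Cyl_sub_coordinates (I : choiceType) (J : set I) :
  Cyl J `<=` <<s [set [set x : I -> bool | x j] | j in J] >>.
Proof.
set G := (X in <<s X >>).
have sG : sigma_algebra setT <<s G >> by exact: smallest_sigma_algebra.
move=> A [F [/finite_seqP[s ->{F}]]]; elim: s A => [|j s IH] A sJ detA.
  have [[x Ax]|/nonemptyPn->] := pselect (A !=set0); last by case: sG.
  rewrite (_ : A = setT); last by apply/seteqP; split=> // y _; apply: detA Ax _.
  by case: sG => G0 /(_ _ G0); rewrite setD0.
pose upd b (x : I -> bool) i := if i == j then b else x i.
have GA b : <<s G >> (upd b @^-1` A).
  apply: IH => [i si|x y /= Ax E]; first by apply: sJ; rewrite /= inE si orbT.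
  apply: detA Ax _ => i /=; rewrite inE /upd; case: eqP => //= _; exact: E.
have Gj : <<s G >> [set x : I -> bool | x j].
  by apply: sub_sigma_algebra; exists j => //; apply: sJ; rewrite /= inE eqxx.
pose X := [set x : I -> bool | x j].
have AE : A = (X `&` upd true @^-1` A) `|` (~` X `&` upd false @^-1` A).
  have updE x : upd (x j) x = x.
    by apply/funext => i; rewrite /upd; case: eqP => [->|].
  apply/seteqP; split=> x /=; rewrite /X /=.
  - case xj: (x j) => Ax; [left|right]; split=> //.
    + by rewrite /= -xj updE.
    + by rewrite /= -xj updE.
  - case=> -[xj]; first by rewrite -[in X in _ X -> _]xj updE.
    by move/negP/negbTE : xj => <-; rewrite updE.
have mI (B C : set (I -> bool)) : <<s G >> B -> <<s G >> C -> <<s G >> (B `&` C).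
  by move=> mB mC; exact: (@measurableI _ (g_sigma_algebraType G)).
rewrite {}AE; apply: (@measurableU _ (g_sigma_algebraType G)); apply: mI.
- exact: Gj.
- exact: (GA true).
- by rewrite -setTD; case: sG => _ /(_ _ Gj).
- exact: (GA false).
Qed.

(** * Extension of finitely additive probabilities *)

Section AtomSum.
Variables (R : realType) (T : Type) (F : set (set T)) (mu : set T -> R).
Variable pk : set T -> T.
Hypothesis algF : set_algebra F.
Hypothesis muF : fa_measure F mu.
Hypothesis pkP : forall D, D !=set0 -> D (pk D).

(* The sum of mu a * 1_B (pk a) over the atoms a of the partition of D
   generated by s. *)
Fixpoint atom_sum (s : seq (set T)) (D B : set T) : R :=
  if s is A :: s' then atom_sum s' (D `&` A) B + atom_sum s' (D `\` A) B
  else mu D * (`[< B (pk D) >])%:R.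

Let FD A B : F A -> F B -> F (A `\` B).
Proof. by case: algF => -[_ _ +] _; apply. Qed.

Let FI A B : F A -> F B -> F (A `&` B).
Proof. by move=> FA FB; rewrite -setDD; do 2?apply: FD. Qed.

Lemma fa_measure_setID D A : F D -> F A ->
  mu D = mu (D `&` A) + mu (D `\` A).
Proof.
move=> FD' FA; case: muF => _ <-; [|exact: FI|exact: FD|].
  by rewrite setUIDK.
by rewrite setDE setIACA setICr setI0.
Qed.

Lemma fa_measure0 : mu set0 = 0.
Proof.
have F0 : F set0 by case: algF => -[].
case: muF => _ /(_ _ _ F0 F0); rewrite setU0 setI0 => /(_ erefl)/eqP.
by rewrite addrC -subr_eq subrr eq_sym => /eqP.
Qed.

Let consP (A : set T) s : (forall C, C \in A :: s -> F C) ->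
  F A /\ (forall C, C \in s -> F C).
Proof.
by move=> Fs; split=> [|C Cs]; apply: Fs; rewrite inE ?eqxx// Cs orbT.
Qed.

Lemma atom_sum_ge0 s D B : (forall A, A \in s -> F A) -> F D ->
  0 <= atom_sum s D B.
Proof.
elim: s D => [|A s IH] D /=; first by case: muF => + _ _ FD' => /(_ _ FD') m0;
  rewrite mulr_ge0.
by move=> /consP[FA Fs] FD'; rewrite addr_ge0 ?IH//; [exact: FI|exact: FD].
Qed.

(** Point masses are additive on all sets, so [B] and [C] may lie outside [F]; this makes the later
    limit a measure on the whole power set. *)
Lemma atom_sum_setU s D B C : B `&` C = set0 ->
  atom_sum s D (B `|` C) = atom_sum s D B + atom_sum s D C.
Proof.
move=> BC0; elim: s D => [|A s IH] D /=; last by rewrite !IH addrACA.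
rewrite -mulrDr; congr (_ * _); rewrite asbool_or.
case: asboolP => Bp; case: asboolP => Cp //=; rewrite ?addr0 ?add0r//.
by have : (B `&` C) (pk D) by []; rewrite BC0.
Qed.

Lemma atom_sum_subset s D B : (forall A, A \in s -> F A) -> F D ->
  D `<=` B -> atom_sum s D B = mu D.
Proof.
elim: s D => [|A s IH] D /= => [_ FD' DB|/consP[FA Fs] FD' DB].
  have [/pkP/DB pB|/nonemptyPn->] := pselect (D !=set0).
    by rewrite asboolT// mulr1.
  by rewrite fa_measure0 mul0r.
rewrite [RHS](fa_measure_setID FD' FA) !IH//; [exact: FD|..|exact: FI|].
- by move=> x [/DB].
- by move=> x [/DB].
Qed.

Lemma atom_sum_disjoint s D B : (forall A, A \in s -> F A) -> F D ->
  D `&` B = set0 -> atom_sum s D B = 0.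
Proof.
elim: s D => [|A s IH] D /= => [_ FD' DB|/consP[FA Fs] FD' DB].
  have [/pkP pD|/nonemptyPn->] := pselect (D !=set0).
    rewrite asboolF ?mulr0// => Bp.
    by have : (D `&` B) (pk D) by []; rewrite DB.
  by rewrite fa_measure0 mul0r.
rewrite !IH ?addr0//; [exact: FD| |exact: FI|].
- by rewrite ?setDE setIAC DB set0I.
- by rewrite ?setDE setIAC DB set0I.
Qed.

(** After the cut along [B], every atom lies inside [B] or is disjoint from it, so its point mass
    counts fully or not at all; cuts along other sets just add up. *)
Lemma atom_sum_mem s D B : (forall A, A \in s -> F A) -> F D ->
  B \in s -> atom_sum s D B = mu (D `&` B).
Proof.
elim: s D => //= A s IH D /consP[FA Fs] FD'; rewrite inE => /orP[/eqP->|Bs].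
  rewrite atom_sum_subset//; [|exact: FI].
  rewrite atom_sum_disjoint ?addr0//; first exact: FD.
  by rewrite setDE -setIA setICl setI0.
rewrite !IH//; [|exact: FD|exact: FI].
rewrite [RHS](@fa_measure_setID _ A)//; last by apply: FI => //; exact: Fs.
by rewrite !setDE (setIAC D A) (setIAC D (~` A)).
Qed.

End AtomSum.

(** Compactness gives a cluster point, which is a limit because an ultrafilter contains the preimage
    of [V] or its complement. *)
Lemma compact_ultra_map (I : Type) (X : topologicalType) (U : set_system I)
    (f : I -> X) (K : set X) : UltraFilter U -> compact K ->
  U (f @^-1` K) -> exists p : X, f @ U --> p.
Proof.
move=> UU Kc UK; have [p [_ clp]] := Kc (f @ U) _ UK.
exists p => V Vp; have [//|UnV] := in_ultra_setVsetC (f @^-1` V) UU.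
by have [y [nVy Vy]] := clp (~` V) V UnV Vp.
Qed.

(* The extension is the limit, along an ultrafilter on the finite subfamilies s
   of F ordered by refinement, of sums of point masses in the atoms of s. *)
Lemma fa_probability_extend (R : realType) (T : Type) (F : set (set T))
    (mu : set T -> R) : set_algebra F -> fa_probability F mu ->
  exists nu : set T -> R, fa_probability setT nu /\ agree_on F nu mu.
Proof.
move=> algF [muF muT]; have [_ FT] := algF.
have [x0 _] : [set: T] !=set0.
  apply: contrapT => /nonemptyPn T0; move: muT.
  by rewrite T0 (fa_measure0 algF muF) => /esym/eqP; rewrite oner_eq0.
have /choice[pk pkP] (D : set T) : exists x, D !=set0 -> D x.
  have [[x Dx]|nD] := pselect (D !=set0); first by exists x.
  by exists x0.
pose subF := [set s : seq (set T) | forall A, A \in s -> F A].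
pose finer (s : seq (set T)) := subF `&` [set t | {subset s <= t}].
have [U [UU finerU]] : exists U, UltraFilter U /\ filter_from subF finer `<=` U.
  apply: ultraFilterLemma; apply: filter_from_proper; last first.
    by move=> s Fs; exists s; split.
  apply: filter_from_filter; first by exists [::] => A; rewrite in_nil.
  move=> s t Fs Ft; exists (s ++ t).
    by move=> A; rewrite mem_cat => /orP[/Fs|/Ft].
  move=> r [Fr str]; split; split=> // A Ar; apply: str.
    by rewrite mem_cat Ar.
  by rewrite mem_cat Ar orbT.
pose m s B := atom_sum mu pk s setT B.
have Ufiner s : subF s -> U (finer s) by move=> Fs; apply: finerU; exists s.
have UsubF : U subF.
  have /Ufiner : subF [::] by move=> A; rewrite in_nil.
  by apply: filterS => s [].
have mT s : subF s -> m s setT = 1.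
  by move=> Fs; rewrite -muT /m (atom_sum_subset algF muF pkP).
have m_ge0 s B : subF s -> 0 <= m s B.
  by move=> Fs; exact: (atom_sum_ge0 _ algF muF).
have m_le1 s B : subF s -> m s B <= 1.
  move=> Fs; rewrite -(mT s)// -(setUv B) /m atom_sum_setU ?setICr//.
  by rewrite lerDl; exact: m_ge0.
(* The sums stay in a compact interval, so they converge along [U] for every [B]. *)
have /choice[nu nuP] B : exists l : R, m ^~ B @ U --> l.
  apply: (@compact_ultra_map _ R U (fun s => m s B) `[0, 1]%classic) => //.
    exact: segment_compact.
  apply: filterS UsubF => s Fs /=; rewrite in_itv/=.
  by rewrite m_ge0// m_le1.
have nuE B (l : R) : (\forall s \near U, m s B = l) -> nu B = l.
  move=> Bl; apply: (cvg_unique (@norm_hausdorff _ R) (nuP B)) => //.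
  exact: cvg_near_cst.
exists nu; split; first split; first split.
- move=> B _; apply: (cvgr_to_ge (nuP B)).
  by apply: filterS UsubF => s; exact: m_ge0.
- move=> B C _ _ BC0.
  apply: (cvg_unique (@norm_hausdorff _ R) (nuP (B `|` C))) => //.
  apply: cvg_trans (cvgD (nuP B) (nuP C)); apply: near_eq_cvg.
  by near=> s; rewrite /m /= atom_sum_setU.
- by apply: nuE; apply: filterS UsubF => s; exact: mT.
- move=> A FA; apply: nuE.
  (* Every family containing [A] already gives [A] its exact measure. *)
  have /Ufiner : subF [:: A] by move=> C; rewrite inE => /eqP->.
  apply: filterS => s [Fs As]; rewrite /m (atom_sum_mem algF muF pkP)//.
    by rewrite setTI.
  by apply: As; rewrite inE.
Unshelve. all: by end_near. Qed.

(** * The algebras [Ba] and cardinal successors *)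

Lemma card_Ba_continuum (I : choiceType) (J : set I) :
  J #<= [set: set nat] -> Ba J #<= [set: set nat].
Proof.
move=> Jle.
have sBa : Ba J `<=` <<s [set [set x : I -> bool | x j] | j in J] >>.
  apply: smallest_sub; first exact: smallest_sigma_algebra.
  exact: Cyl_sub_coordinates.
apply: card_le_trans (subset_card_le sBa) _.
apply: card_sigma_algebra_continuum.
exact: card_le_trans (card_image_le _ _) Jle.
Qed.

(** Being determined by no coordinates survives complements and countable unions. This makes the
    first algebra of the chain trivial. *)
Lemma Ba_set0 (I : Type) (A : set (I -> bool)) :
  Ba set0 A -> A !=set0 -> A = setT.
Proof.
move=> BaA; have : determined_by set0 A.
  apply: (smallest_sub _ _ BaA) => [|B [F [_ F0]] detB x y Bx _]; last first.
    by apply: detB Bx _ => j /F0.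
  split=> [//|B detB x y [_ nBx] _|B detB x y [n _ Bnx] _].
    by split=> // By; apply: nBx; apply: detB By _.
  by exists n => //; apply: detB Bnx _.
move=> detA [x Ax]; apply/seteqP; split=> // y _; exact: detA Ax _.
Qed.

Lemma is_card_succ_eq (T T' U U' : Type) (A : set T) (B : set U)
    (A' : set T') (B' : set U') :
  A #= A' -> B #= B' -> is_card_succ A B -> is_card_succ A' B'.
Proof.
move=> AA' BB' [BA AB subA]; split=> [||C CA'].
- by rewrite -(card_le_eql BB') -(card_le_eqr AA').
- by rewrite -(card_le_eql AA') -(card_le_eqr BB').
have CA : C #<= A by rewrite (card_le_eqr AA'); exact: subset_card_le.
elim/Ppointed: T => T in A AA' BA AB subA CA *.
  by case: AB; rewrite empty_eq0.
(* [C] is copied into [A], where the dichotomy for subsets applies. *)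
have /pcard_leP[g] := CA.
have CgC : g @` C #= C by exact: inj_card_eq.
case: (subA (g @` C)); first by move=> _ [x Cx <-]; exact: funS.
- by left; rewrite -(card_le_eql CgC) -(card_le_eqr BB').
- by right; rewrite -(card_eql CgC) -(card_eqr AA').
Qed.

(** * Well-ordered index sets, limits and regularity *)

Section WellOrder.
Context {d : Order.disp_t} {W : orderType d}.
Hypothesis woW : wochoice.well_order (<=%O : rel W).

Lemma well_order_min (P : set W) : P !=set0 ->
  exists2 m, P m & forall x, P x -> (m <= x)%O.
Proof.
case=> w Pw; have [|m [[]]] := woW (A := [pred x | `[< P x >]]).
  by exists w; rewrite inE.
rewrite inE => Pm minm _; exists m => // x Px.
by apply: minm; rewrite inE.
Qed.

Lemma is_succ_exists xi : (exists y, (xi < y)%O) -> exists eta : W, is_succ xi eta.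
Proof. by case/(well_order_min (P := [set y | xi < y]%O)) => m; exists m. Qed.

(** The least [m] with [x] in [A_ m] is outside [S], since at a limit [x] would appear earlier; so
    inclusions out of indices not in [S] suffice. *)
Lemma chain_homo (V : Type) (S : set W) (A_ : W -> set V) :
  (forall xi, S xi -> limit_ordinal xi) ->
  (forall xi, limit_ordinal xi ->
     A_ xi = \bigcup_(alpha in initseg xi) A_ alpha) ->
  (forall a b, ~ S a -> (a < b)%O -> A_ a `<=` A_ b) ->
  forall a b, (a <= b)%O -> A_ a `<=` A_ b.
Proof.
move=> Slim Alim AnS a b; rewrite le_eqVlt => /predU1P[->//|ab] x Aax.
have [|m Amx mmin] := @well_order_min [set m | A_ m x]; first by exists a.
have [/Slim/Alim Am|nSm] := pselect (S m); last first.
  by apply: AnS Amx => //; exact: le_lt_trans (mmin _ Aax) ab.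
move: Amx; rewrite /= Am => -[c /= cm] /mmin.
by rewrite leNgt cm.
Qed.

End WellOrder.

(** At zero the empty set is cofinal, at a successor a single point is, and neither is as large as
    nat. *)
Lemma cofinality_nat_limit d (W : orderType d) (xi : W) :
  has_cofinality (ord_type xi) [set: nat] -> limit_ordinal xi.
Proof.
case=> _ cofP; split.
  apply: contrapT => nex; have /cofP/card_le0P : cofinal (@set0 (ord_type xi)).
    by move=> [x xxi]; case: nex; exists x.
  by move/seteqP => [/(_ 0%N I)].
move=> eta etaxi; apply: contrapT => nex.
have /cofP/infiniteP : cofinal [set (exist _ eta etaxi : ord_type xi)].
  move=> [x xxi]; exists (exist _ eta etaxi : ord_type xi) => //.
  by rewrite [leLHS]/=; case: (leP x eta) => // etax; case: nex; exists x; rewrite etax.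
by apply; exact: finite_set1.
Qed.

(** A form of regularity: were the ranks unbounded, each [x] would be determined by some [b] of rank
    above [x] and the code of [x] in the segment below that rank, so [W] would have size at most the
    continuum. *)
Lemma rank_bounded d (W : orderType d) (V : Type) (B : set V) (rk : V -> W) :
  (forall x : W, initseg x #<= [set: set nat]) ->
  ~ ([set: W] #<= [set: set nat]) ->
  B #<= [set: set nat] -> exists x, forall b, B b -> (rk b <= x)%O.
Proof.
move=> hseg WN /pcard_injP[e einj].
have /choice[h hinj] x := elimT pcard_injP (hseg x).
apply: contrapT => nbd.
have /choice[b bP] x : exists b, B b /\ (x < rk b)%O.
  apply: contrapT => nb; apply: nbd; exists x => b Bb.
  by rewrite leNgt; apply/negP => xb; apply: nb; exists b.
apply: WN; apply: card_le_trans card_le_continuum_prod.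
apply: (@card_le_injT _ _ (fun x => (e (b x), h (rk (b x)) x))) => x y [eb].
have bxy : b x = b y by apply: einj; rewrite ?inE ?eb//; case: (bP x); case: (bP y).
rewrite -bxy; apply: hinj; rewrite inE /=; first by case: (bP x).
by rewrite bxy; case: (bP y).
Qed.

(** * The union of the chain of algebras *)

(* In (i) the upper bound Ba^<[xi] is required at limit xi only, see BaLt. *)
Theorem theorem4p7 (R : realType)
  (d1 d2 : Order.disp_t) (W1 : orderType d1) (W2 : orderType d2)
  (omega1P : is_omega1 W1) (omega2P : is_omega2 W2 W1)
  (CH : [set: set nat] #= [set: W1])
  (CH1 : [set: set W1] #= [set: W2])
  (S : set W2)
  (S_stat : stationary S)
  (S_cof : forall alpha, S alpha -> has_cofinality (ord_type alpha) [set: nat])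
  (S_nonrefl : forall beta : W2, has_cofinality (ord_type beta) [set: W1] ->
     ~ stationary (ord_trace beta S))
  (nu_ : W2 -> set (W2 -> bool) -> R)
  (nu_prob : forall xi, S xi -> fa_probability (BaLt xi) (nu_ xi))
  (nu_guess : forall nu : set (W2 -> bool) -> R,
     fa_probability (Ba [set: W2]) nu ->
     stationary [set xi | S xi /\ agree_on (BaLt xi) nu (nu_ xi)])
  (A_ : W2 -> set (set (W2 -> bool)))
  (A_alg : forall xi, set_algebra (A_ xi))
  (A_i : forall xi,
     [/\ Cyl (initseg xi) `<=` A_ xi,
         A_ xi `<=` Ba (initseg xi)
       & limit_ordinal xi -> A_ xi `<=` BaLt xi])
  (A_ii : forall xi, limit_ordinal xi ->
     A_ xi = \bigcup_(alpha in initseg xi) A_ alpha)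
  (A_iii : forall alpha beta, ~ S alpha -> (alpha < beta)%O ->
     forall mu : set (W2 -> bool) -> R,
     fa_probability (A_ alpha) mu -> strictly_positive (A_ alpha) mu ->
     exists mu', sp_extension (A_ alpha) mu (A_ beta) mu')
  (A_iv : forall xi xi1, S xi -> is_succ xi xi1 ->
     ~ exists mu', sp_extension (A_ xi) (nu_ xi) (A_ xi1) mu') :
  let AA := \bigcup_(xi in [set: W2]) A_ xi in
  [/\ set_algebra AA,
      is_card_succ AA [set: set nat],
      ~ SPM R AA
    & forall BB : set (set (W2 -> bool)),
        set_algebra BB -> BB `<=` AA -> BB #<= [set: set nat] -> SPM R BB].
Proof.
move=> AA.
have wo2 : wochoice.well_order (<=%O : rel W2) by case: omega2P => -[].
have /card_eqPle[cW1 W1c] := CH.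
have nW2c : ~ ([set: W2] #<= [set: set nat]).
  case: omega2P => _ [_ nW21 _] W2c; apply: nW21.
  exact: card_le_trans W2c cW1.
(* A segment has size at most that of [W1] or equal to that of [W2]; the latter contradicts
   initiality. *)
have segc (x : W2) : initseg x #<= [set: set nat].
  case: omega2P => -[_ nseg] [_ _ /(_ (initseg x) (@subsetT _ _))[segW1|]].
    exact: card_le_trans segW1 W1c.
  by move/card_eqPle => [_ /nseg].
have nomax (x : W2) : exists y : W2, (x < y)%O.
  apply: contrapT => xmax; apply: nW2c.
  have [f finj] := elimT pcard_injP (segc x).
  apply: card_le_trans card_le_continuum_sum.
  pose g y : set nat + set nat := if y == x then inr set0 else inl (f y).
  have ltx y : y <> x -> y \in initseg x.
    move=> yx; rewrite inE /=; case: (ltgtP y x) => // xy.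
    by case: xmax; exists y.
  apply: (@card_le_injT _ _ g) => y z; rewrite /g.
  case: eqP => [->|/ltx yx]; case: eqP => [->//|/ltx zx] //= [].
  exact: finj.
have Slim xi : S xi -> limit_ordinal xi by move/S_cof/cofinality_nat_limit.
have [x0 _] : [set: W2] !=set0.
  by apply: contrapT => /nonemptyPn W0; apply: nW2c; rewrite W0 card_ge0.
have [z _ zmin] := well_order_min wo2 (ex_intro _ x0 I : [set: W2] !=set0).
have nSz : ~ S z.
  by move/Slim => [[y]]; rewrite ltNge zmin.
have spA b : exists mu : set (W2 -> bool) -> R,
    fa_probability (A_ b) mu /\ strictly_positive (A_ b) mu.
  have Azfull A : A_ z A -> A !=set0 -> A = setT.
    move=> AzA; apply: Ba_set0; have [_ + _] := A_i z => /(_ _ AzA).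
    rewrite (_ : initseg z = set0)//; apply/seteqP; split=> // y.
    by rewrite /initseg /= ltNge zmin.
  (* As the whole cube is the only nonempty member of [A_ z], this two-valued function is additive
     there. *)
  pose mu (A : set (W2 -> bool)) : R := (`[< A !=set0 >])%:R.
  have muz : fa_probability (A_ z) mu.
    split; last by rewrite /mu asboolT//; exists (fun=> true).
    have mu0 : mu set0 = 0 by rewrite /mu asboolF// => -[].
    split=> [A _|A B AzA AzB AB0]; first by rewrite /mu ler0n.
    have [A0|/nonemptyPn A0] := pselect (A !=set0); last first.
      by rewrite A0 set0U mu0 add0r.
    have [B0|/nonemptyPn B0] := pselect (B !=set0); last first.
      by rewrite B0 setU0 mu0 addr0.
    move: AB0; rewrite (Azfull A)// setTI => B00.
    by move: B0; rewrite B00 => -[].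
  have spz : strictly_positive (A_ z) mu.
    by move=> A _ A0; rewrite /mu asboolT.
  have := zmin b I; rewrite le_eqVlt => /predU1P[<-|zb]; first by exists mu.
  by have [mu' [_ _ ? ?]] := A_iii z b nSz zb mu muz spz; exists mu'.
have Amono : forall a b, (a <= b)%O -> A_ a `<=` A_ b.
  apply: (chain_homo wo2 Slim A_ii) => a b nSa ab.
  have [mu [muP mu_sp]] := spA a.
  by have [mu' []] := A_iii a b nSa ab mu muP mu_sp.
have AAsub : AA `<=` Ba setT.
  move=> A [a _ AaA]; have [_ /(_ _ AaA) + _] := A_i a.
  apply: (sub_smallest2r (smallest_sigma_algebra _ _)).
  by move=> E [F [finF _ detF]]; exists F; split.
have AA2 A B : AA A -> AA B -> exists a, A_ a A /\ A_ a B.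
  move=> [a _ AaA] [b _ AbB]; have [ab|/ltW ba] := leP a b.
    by exists b; split=> //; exact: Amono AaA.
  by exists a; split=> //; exact: Amono AbB.
have AA_alg : set_algebra AA.
  split; last by exists x0 => //; case: (A_alg x0).
  split; first by exists x0 => //; case: (A_alg x0) => -[].
  - move=> A B AAA AAB; have [a [AaA AaB]] := AA2 _ _ AAA AAB; exists a => //.
    by case: (A_alg a) => -[_ + _] _; apply.
  - move=> A B AAA AAB; have [a [AaA AaB]] := AA2 _ _ AAA AAB; exists a => //.
    by case: (A_alg a) => -[_ _ +] _; apply.
have W1W2 : [set: set (set nat)] #= [set: W2].
  apply: card_eq_trans CH1; apply: Cantor_Bernstein; exact: card_le_powerset.
split=> //.
- apply: is_card_succ_eq (proj2 omega2P); last by rewrite card_eq_sym.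
  apply: Cantor_Bernstein; last first.
    rewrite -(card_le_eqr W1W2); apply: card_le_bigcup_continuum => [|x].
      by rewrite (card_le_eqr W1W2).
    have [_ AxBa _] := A_i x.
    exact: card_le_trans (subset_card_le AxBa) (card_Ba_continuum (segc x)).
  (* Distinct coordinates have distinct half-spaces, told apart by the indicator point of one of
     them. *)
  apply: (@card_le_inj _ _ _ _ (fun j : W2 => [set x : W2 -> bool | x j])).
    move=> j _; have [k jk] := nomax j; exists k => //.
    have [+ _ _] := A_i k; apply; exists [set j]; split.
    - exact: finite_set1.
    - by move=> _ ->.
    - by move=> x y /= xj /(_ j erefl) ->.
  move=> i j _ _ E; have : [set x : W2 -> bool | x i] (pred1 i) by rewrite /= eqxx.
  by rewrite E => /eqP.
- case=> mu [[mu0 muD] mu_sp].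
  have muT : 0 < mu setT.
    by apply: mu_sp; [case: AA_alg|exists (fun=> true)].
  pose mu' A := mu A / mu setT.
  have mu'P : fa_probability AA mu'.
    split; last by rewrite /mu' divff// gt_eqF.
    split=> [A AAA|A B AAA AAB AB0]; last by rewrite /mu' muD// mulrDl.
    by apply: divr_ge0; [exact: mu0|exact: ltW].
  (* An extension to all sets is in particular defined on [Ba setT], where the guessing hypothesis
     applies. *)
  have [nu [[[nu0 nuD] nuT] nuE]] := fa_probability_extend AA_alg mu'P.
  have nuP F : fa_probability F nu.
    by split=> //; split=> [A _|A B _ _]; [exact: nu0|exact: nuD].
  have cofT : cofinal [set: W2] by move=> x; exists x.
  have [xi [[Sxi nuxi] _]] := nu_guess nu (nuP _) setT (@closedT _) cofT.
  have [xi1 xi1P] := is_succ_exists wo2 (nomax xi).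
  apply: (A_iv xi xi1 Sxi xi1P); exists nu; split=> //.
  + by apply: Amono; apply: ltW; case: xi1P.
  (* [xi] is a limit, so [A_ xi] lies inside [BaLt xi], where [nu] was guessed. *)
  + move=> A AxiA; apply: nuxi; have [_ _ /(_ (Slim _ Sxi))] := A_i xi.
    exact.
  + move=> A AA1 A0; have AAA : AA A by exists xi1.
    by rewrite nuE// /mu' divr_gt0// mu_sp.
- move=> BB BB_alg BBsub BBc.
  (* [rk] picks a stage containing each member of [AA], with [x0] as default elsewhere. *)
  have /choice[rk rkP] A : exists a, AA A -> A_ a A.
    have [[a _ ?]|nA] := pselect (AA A); first by exists a.
    by exists x0.
  have [b bP] := rank_bounded rk segc nW2c BBc.
  have BBb : BB `<=` A_ b.
    by move=> A BBA; apply: Amono (bP _ BBA) _ _; exact/rkP/BBsub.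
  have [mu [[[mu0 muD] _] mu_sp]] := spA b.
  exists mu; split; last by move=> A /BBb; exact: mu_sp.
  by split=> [A /BBb|A B /BBb + /BBb]; [exact: mu0|exact: muD].
Qed.
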